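(* Let $(g,m_0,m_1)$ be the data of an isometric cohomogeneity one action on a sphere. The spectral problem $$\xi''(x)+\tfrac12\big(m_0-m_1+(2-(m_0+m_1))\tanh(x)\big)\xi'(x)-\tfrac12\big(m_0+m_1-(m_0-m_1)\tanh(x)\big)\xi(x)+\Big(\lambda+\frac{m_0+m_1}{g}\Big)\frac{\xi(x)}{\cosh^2(x)}=0,\qquad x\in\mathbb{R},$$ describing the equivariant stability of the identity map, parametrized by $r(x)=\frac{2}{g}\arctan(e^x)$, is solved by $$\xi_j(x)=\frac{1}{\cosh(x)}\,P^{\left(\frac{m_1+1}{2},\frac{m_0+1}{2}\right)}_{j-1}\big(\tanh(x)\big),\qquad \lambda_j=-\frac{m_0+m_1}{g}+j\Big(j+\frac{m_0+m_1}{2}\Big),$$ where $j\in\{1,2,3,\dots\}$.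
   Context: Data: for an isometric cohomogeneity one action on the round sphere $\mathbb{S}^{n+1}$, $g$ is the number of distinct principal curvatures of the principal orbits, whose multiplicities $m_i$ satisfy $m_i=m_0$ for $i$ even and $m_i=m_1$ for $i$ odd, so $n=\frac{g(m_0+m_1)}{2}$; $g,m_0,m_1$ are positive integers. Origin of the problem: equivariant self-maps $a\cdot\gamma(t)\mapsto a\cdot\gamma(r(t))$ along a unit speed normal geodesic $\gamma$, $t\in[0,\pi/g]$, have Jacobi equation $$\ddot\xi+\big(m_0-m_1+(m_0+m_1)\cos(gt)\big)\tfrac{g}{2\sin(gt)}\dot\xi-\tfrac{g}{2\sin^2(gt)}\Big[(g-2)\cos(2(r(t)-t))\big(m_0+m_1+(m_0-m_1)\cos(gt)\big)+2\cos(2(r(t)-t)+gt)\big(m_0-m_1+(m_0+m_1)\cos(gt)\big)\Big]\xi+\lambda\xi=0.$$ For $r(t)=t$ (the identity map) the change of variables $t=\frac2g\arctan(e^x)$, with $\lambda$ rescaled by the factor $g^2$, gives the spectral problem of the claim. $P_k^{(\alpha,\beta)}$, $k\ge 0$, denotes the Jacobi polynomial of degree $k$, a polynomial solution of $(1-y^2)f''(y)+\big(\beta-\alpha-(\alpha+\beta+2)y\big)f'(y)+k(k+1+\alpha+\beta)f(y)=0$, namely $P_k^{(\alpha,\beta)}(y)=\frac{(\alpha+1)_k}{k!}\,{}_2F_1\big(-k,k+1+\alpha+\beta;\alpha+1;\tfrac{1-y}{2}\big)$. *)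

(* Defs.v *)
From Stdlib Require Import Reals Factorial.
From Coquelicot Require Import Coquelicot.
Open Scope R_scope.

(* The rising factorial (a)_k = a (a + 1) ... (a + k - 1). *)
Fixpoint pochhammer (a : R) (k : nat) : R :=
  match k with
  | O => 1
  | S k' => pochhammer a k' * (a + INR k')
  end.

(* Gauss's hypergeometric series 2F1(a, b; c; z); it terminates when a or b is
   a nonpositive integer. *)
Definition hyp2F1 (a b c z : R) : R :=
  PSeries
    (fun i => pochhammer a i * pochhammer b i / (pochhammer c i * INR (fact i)))
    z.

Definition jacobiP (k : nat) (alpha beta y : R) : R :=
  pochhammer (alpha + 1) k / INR (fact k) *
  hyp2F1 (- INR k) (INR k + 1 + alpha + beta) (alpha + 1) ((1 - y) / 2).

(* The pair (lambda, xi) solves the spectral problem: xi is a twice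
   differentiable solution on the whole line and, being an eigenfunction, is
   not identically zero. The differentiability clauses are needed because
   [Derive] is a total operator. *)
Definition solves_spectral_problem
    (g m0 m1 : nat) (lambda : R) (xi : R -> R) : Prop :=
  (exists x, xi x <> 0) /\
  (forall x, ex_derive xi x) /\
  (forall x, ex_derive (Derive xi) x) /\
  (forall x,
     Derive (Derive xi) x
     + / 2 * (INR m0 - INR m1 + (2 - (INR m0 + INR m1)) * tanh x) * Derive xi x
     - / 2 * (INR m0 + INR m1 - (INR m0 - INR m1) * tanh x) * xi x
     + (lambda + (INR m0 + INR m1) / INR g) * (xi x / (cosh x) ^ 2) = 0).

(* Main.v *)
(** With [y = tanh x] and [xi x = f y / cosh x], the spectral equation becomes
    [(1 - y^2) / cosh x] times the Jacobi equation for [f]; matching the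
    zeroth-order coefficient fixes the eigenvalue. In the variable
    [z = (1 - y) / 2] the Jacobi equation is Gauss's hypergeometric equation,
    which is the two-term recurrence between consecutive coefficients of 2F1.
    The solution is nonzero because 2F1 equals 1 at [z = 0], that is, in the
    limit [x -> +oo]. *)
Require Import Defs.
From Stdlib Require Import Reals Factorial Lra Lia.
From Coquelicot Require Import Coquelicot.
Open Scope R_scope.

Definition hyp2F1_coeff (a b c : R) (i : nat) : R :=
  pochhammer a i * pochhammer b i / (pochhammer c i * INR (fact i)).

Lemma pochhammer_pos (a : R) (k : nat) : 0 < a -> 0 < pochhammer a k.
Proof.
intros Ha; induction k as [|k IH]; simpl; [lra|].
pose proof (pos_INR k); apply Rmult_lt_0_compat; lra.
Qed.

Lemma pochhammer_neg_nat_eq0 (k i : nat) :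
  (k < i)%nat -> pochhammer (- INR k) i = 0.
Proof.
induction i as [|i IH]; intros Hi; [lia|simpl].
destruct (Nat.eq_dec k i) as [->|Hne]; [ring|].
rewrite IH by lia; ring.
Qed.

(** Each rising factorial gains one factor from [n] to [S n]; [0 < c] keeps the denominators
    nonzero. *)
Lemma hyp2F1_coeff_rec (a b c : R) (n : nat) : 0 < c ->
  INR (S n) * (c + INR n) * hyp2F1_coeff a b c (S n)
  = (a + INR n) * (b + INR n) * hyp2F1_coeff a b c n.
Proof.
intros Hc; unfold hyp2F1_coeff.
rewrite fact_simpl, mult_INR; simpl pochhammer.
pose proof (pochhammer_pos c n Hc); pose proof (INR_fact_neq_0 n).
pose proof (pos_INR n).
assert (INR (S n) <> 0) by (apply not_0_INR; lia).
field; repeat split; lra.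
Qed.

(** [CV_radius] is the supremum of [CV_disk u]; this set contains every real, so its supremum is
    neither finite nor minus infinity. *)
Lemma CV_radius_finite_support (u : nat -> R) (k : nat) :
  (forall n, (k < n)%nat -> u n = 0) -> CV_radius u = p_infty.
Proof.
intros Hu.
assert (Hdisk : forall r, CV_disk u r).
{ intros r; unfold CV_disk.
  apply (ex_series_incr_n _ (S k)).
  apply ex_series_ext with (fun _ => 0).
  - intros n; rewrite Hu by lia; rewrite Rmult_0_l, Rabs_R0; reflexivity.
  - exists 0; change (is_lim_seq (sum_n (fun _ : nat => 0)) 0).
    apply (is_lim_seq_ext (fun _ => 0)); [|apply is_lim_seq_const].
    intros n; rewrite sum_n_const; ring. }
destruct (Lub_Rbar_correct (CV_disk u)) as [Hub _].
unfold CV_radius; destruct (Lub_Rbar (CV_disk u)) as [r| |]; [| reflexivity |].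
- specialize (Hub (r + 1) (Hdisk _)); simpl in Hub; lra.
- destruct (Hub 0 (Hdisk _)).
Qed.

Lemma PSeries_hyp2F1_ode (a b c z : R) :
  0 < c -> Rbar_lt (Rabs z) (CV_radius (hyp2F1_coeff a b c)) ->
  let u := hyp2F1_coeff a b c in
  z * (1 - z) * PSeries (PS_derive (PS_derive u)) z
  + (c - (a + b + 1) * z) * PSeries (PS_derive u) z
  - a * b * PSeries u z = 0.
Proof.
intros Hc Hz u.
assert (E0 : ex_pseries u z) by (apply CV_radius_inside; exact Hz).
assert (E1 : ex_pseries (PS_derive u) z) by (apply ex_pseries_derive; exact Hz).
assert (E2 : ex_pseries (PS_derive (PS_derive u)) z).
{ apply ex_pseries_derive; rewrite CV_radius_derive; exact Hz. }
assert (Escal : forall (s : R) (v : nat -> R), ex_pseries v z -> ex_pseries (PS_scal s v) z).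
{ intros s v; apply ex_pseries_scal, Rmult_comm. }
(* Gauss's equation with the subtracted terms moved to the right. The coefficients of degree [n] are
   [(n + 1) (c + n) u (n + 1)] and [(n (n - 1) + (a + b + 1) n + a b) u n = (a + n) (b + n) u n]. *)
assert (H : PSeries (PS_plus (PS_incr_1 (PS_derive (PS_derive u)))
                             (PS_scal c (PS_derive u))) z
          = PSeries (PS_plus (PS_incr_1 (PS_incr_1 (PS_derive (PS_derive u))))
                (PS_plus (PS_scal (a + b + 1) (PS_incr_1 (PS_derive u)))
                         (PS_scal (a * b) u))) z).
{ apply PSeries_ext; intros n.
  pose proof (hyp2F1_coeff_rec a b c n Hc) as Hrec; fold u in Hrec.
  unfold PS_plus, PS_scal, PS_derive.
  (* Multiplication by [z ^ 2] shifts twice, so degrees 0 and 1 are separate cases. *)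
  destruct n as [|[|n]]; cbn [PS_incr_1]; rewrite ?S_INR in *;
    unfold plus, scal, zero; simpl; unfold mult; simpl;
    rewrite ?S_INR; simpl INR in *; lra. }
rewrite !PSeries_plus, !PSeries_scal, !PSeries_incr_1 in H;
  auto using ex_pseries_incr_1, ex_pseries_plus.
lra.
Qed.

Lemma cosh_pos (x : R) : 0 < cosh x.
Proof. unfold cosh; pose proof (exp_pos x); pose proof (exp_pos (- x)); lra. Qed.

Lemma is_derive_tanh (x : R) : is_derive tanh x (1 - tanh x ^ 2).
Proof.
pose proof (cosh_pos x) as Hc.
evar_last.
- apply (is_derive_ext (fun t => sinh t * / cosh t)); [reflexivity|].
  apply (is_derive_mult sinh (fun t => / cosh t)); [| |apply Rmult_comm].
  + apply is_derive_Reals, derivable_pt_lim_sinh.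
  + apply is_derive_inv; [apply is_derive_Reals, derivable_pt_lim_cosh|lra].
- unfold tanh, plus, mult; simpl; unfold mult; simpl; field; lra.
Qed.

(** The derivative is again [/ cosh] times a function of [tanh], so the rule can be iterated to
    reach the second derivative. *)
Lemma is_derive_sech_mul_comp_tanh (f : R -> R) (x l : R) :
  is_derive f (tanh x) l ->
  is_derive (fun t => / cosh t * f (tanh t)) x
    (/ cosh x * (- tanh x * f (tanh x) + (1 - tanh x ^ 2) * l)).
Proof.
intros Hf; pose proof (cosh_pos x) as Hc.
evar_last.
- apply (is_derive_mult (fun t => / cosh t) (fun t => f (tanh t)));
    [| |apply Rmult_comm].
  + apply is_derive_inv; [apply is_derive_Reals, derivable_pt_lim_cosh|lra].
  + apply (is_derive_comp f tanh); [exact Hf|apply is_derive_tanh].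
- unfold plus, mult, scal, tanh; simpl; unfold mult; simpl; field; lra.
Qed.

Lemma sech_sqr (x : R) : / cosh x ^ 2 = 1 - tanh x ^ 2.
Proof.
pose proof (cosh_pos x) as Hc.
assert (H : cosh x ^ 2 - sinh x ^ 2 = 1).
{ unfold cosh, sinh.
  assert (exp x * exp (- x) = 1) by (rewrite <- exp_plus, Rplus_opp_r; apply exp_0).
  lra. }
apply Rmult_eq_reg_r with (cosh x ^ 2); [|apply pow_nonzero; lra].
rewrite Rinv_l by (apply pow_nonzero; lra); rewrite <- H at 1; unfold tanh.
field; lra.
Qed.

Section JacobiPolynomial.

Variables (k : nat) (alpha beta : R).
Hypothesis alpha_gt : -1 < alpha.

Let u : nat -> R :=
  hyp2F1_coeff (- INR k) (INR k + 1 + alpha + beta) (alpha + 1).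
Let C : R := pochhammer (alpha + 1) k / INR (fact k).

(** Each differentiation in [y] brings out the factor [- / 2] of the substitution
    [z = (1 - y) / 2]. *)
Let jacobiP_derive (y : R) : R := - C / 2 * PSeries (PS_derive u) ((1 - y) / 2).
Let jacobiP_derive2 (y : R) : R :=
  C / 4 * PSeries (PS_derive (PS_derive u)) ((1 - y) / 2).

Lemma CV_radius_jacobi : CV_radius u = p_infty.
Proof.
apply (CV_radius_finite_support u k); intros n Hn; unfold u, hyp2F1_coeff.
rewrite pochhammer_neg_nat_eq0 by exact Hn; unfold Rdiv; ring.
Qed.

Lemma is_derive_PSeries_half (v : nat -> R) (y : R) : CV_radius v = p_infty ->
  is_derive (fun t => PSeries v ((1 - t) / 2)) y
    (- / 2 * PSeries (PS_derive v) ((1 - y) / 2)).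
Proof.
intros Hv.
evar_last.
- apply (is_derive_comp (PSeries v) (fun t => (1 - t) / 2)).
  + apply is_derive_PSeries; rewrite Hv; exact I.
  + auto_derive; [exact I|reflexivity].
- unfold scal; simpl; unfold mult; simpl; lra.
Qed.

Lemma jacobiP_ode_aux (y : R) :
  is_derive (jacobiP k alpha beta) y (jacobiP_derive y) /\
  is_derive jacobiP_derive y (jacobiP_derive2 y) /\
  (1 - y ^ 2) * jacobiP_derive2 y
  + (beta - alpha - (alpha + beta + 2) * y) * jacobiP_derive y
  + INR k * (INR k + 1 + alpha + beta) * jacobiP k alpha beta y = 0.
Proof.
pose proof CV_radius_jacobi as Hu.
split; [|split].
- evar_last.
  + apply (is_derive_scal (fun t => PSeries u ((1 - t) / 2)) y C).
    apply is_derive_PSeries_half, Hu.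
  + unfold jacobiP_derive; simpl; lra.
- evar_last.
  + apply (is_derive_scal (fun t => PSeries (PS_derive u) ((1 - t) / 2))).
    apply is_derive_PSeries_half; rewrite CV_radius_derive; exact Hu.
  + unfold jacobiP_derive2; simpl; lra.
- assert (Hz : Rbar_lt (Rabs ((1 - y) / 2)) (CV_radius u)) by (rewrite Hu; exact I).
  assert (Hc : 0 < alpha + 1) by lra.
  (* With [y = 1 - 2 z]: [1 - y ^ 2 = 4 z (1 - z)], [a + b + 1 = alpha + beta + 2], and [- a b] is
     the zeroth-order coefficient. *)
  pose proof (PSeries_hyp2F1_ode _ _ _ _ Hc Hz) as H; fold u in H.
  cbv zeta in H; apply (f_equal (Rmult C)) in H.
  rewrite Rmult_0_r in H; rewrite <- H.
  change (jacobiP k alpha beta y) with (C * PSeries u ((1 - y) / 2)).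
  unfold jacobiP_derive, jacobiP_derive2; field.
Qed.

End JacobiPolynomial.

Lemma jacobiP_ode (k : nat) (alpha beta : R) : -1 < alpha ->
  exists f1 f2 : R -> R, forall y,
    is_derive (jacobiP k alpha beta) y (f1 y) /\
    is_derive f1 y (f2 y) /\
    (1 - y ^ 2) * f2 y
    + (beta - alpha - (alpha + beta + 2) * y) * f1 y
    + INR k * (INR k + 1 + alpha + beta) * jacobiP k alpha beta y = 0.
Proof. intros Ha; eexists; eexists; apply jacobiP_ode_aux, Ha. Qed.

Lemma jacobiP_1_pos (k : nat) (alpha beta : R) :
  -1 < alpha -> 0 < jacobiP k alpha beta 1.
Proof.
intros Ha; unfold jacobiP, hyp2F1.
replace ((1 - 1) / 2) with 0 by lra; rewrite PSeries_0; simpl.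
replace (1 * 1 / (1 * 1)) with 1 by field; rewrite Rmult_1_r.
apply Rdiv_lt_0_compat; [apply pochhammer_pos; lra|apply INR_fact_lt_0].
Qed.

(** Follows from [1 - tanh x = 2 / (exp (2 x) + 1)] and [1 + 2 x < exp (2 x)]. *)
Lemma one_sub_tanh_bounds (x : R) : 0 < x -> 0 < 1 - tanh x < / x.
Proof.
intros Hx.
assert (H : 1 - tanh x = 2 * / (exp (2 * x) + 1)).
{ unfold tanh, sinh, cosh; rewrite exp_Ropp.
  replace (2 * x) with (x + x) by ring; rewrite exp_plus.
  pose proof (exp_pos x); field; nra. }
pose proof (exp_ineq1 (2 * x) ltac:(lra)) as He.
rewrite H; split.
- apply Rmult_lt_0_compat; [lra|apply Rinv_0_lt_compat; lra].
- replace (/ x) with (2 * / (2 * x)) by (field; lra).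
  apply Rmult_lt_compat_l; [lra|apply Rinv_lt_contravar; nra].
Qed.

(** [tanh] never attains 1, so positivity at 1 is carried by continuity to a nearby value of
    [tanh]. *)
Lemma comp_tanh_neq0 (f : R -> R) :
  continuous f 1 -> 0 < f 1 -> exists x, f (tanh x) <> 0.
Proof.
intros Hf Hpos.
destruct (Hf (fun v => 0 < v)) as [d Hd].
{ exact (open_gt 0 (f 1) Hpos). }
(* At [x = / d] the bound [1 - tanh x < / x] reads [1 - tanh x < d]. *)
exists (/ d); apply Rgt_not_eq, Hd.
pose proof (one_sub_tanh_bounds (/ d)
              (Rinv_0_lt_compat _ (cond_pos d))) as Hb.
rewrite Rinv_inv in Hb.
change (Rabs (tanh (/ d) - 1) < d); apply Rabs_def1; lra.
Qed.

Theorem proposition4p1 (g m0 m1 : nat)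
  (hg : (1 <= g)%nat) (hm0 : (1 <= m0)%nat) (hm1 : (1 <= m1)%nat)
  (j : nat) (hj : (1 <= j)%nat) :
  solves_spectral_problem g m0 m1
    (- ((INR m0 + INR m1) / INR g)
     + INR j * (INR j + (INR m0 + INR m1) / 2))
    (fun x : R =>
       / cosh x * jacobiP (j - 1) ((INR m1 + 1) / 2) ((INR m0 + 1) / 2) (tanh x)).
Proof.
assert (Ha : -1 < (INR m1 + 1) / 2) by (pose proof (pos_INR m1); lra).
pose proof (jacobiP_1_pos (j - 1) _ ((INR m0 + 1) / 2) Ha) as Hpos.
destruct (jacobiP_ode (j - 1) _ ((INR m0 + 1) / 2) Ha) as (f1 & f2 & Hode).
set (f := jacobiP _ _ _) in *.
assert (D1 : forall x, is_derive (fun t => / cosh t * f (tanh t)) x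
  (/ cosh x * (- tanh x * f (tanh x) + (1 - tanh x ^ 2) * f1 (tanh x)))).
{ intros x; apply is_derive_sech_mul_comp_tanh, Hode. }
(* The first derivative of [xi] is [/ cosh x * h (tanh x)], the same shape with [h] in place of
   [f]. *)
set (h := fun y => - y * f y + (1 - y ^ 2) * f1 y).
assert (Dh : forall y, is_derive h y
  (- f y - 3 * y * f1 y + (1 - y ^ 2) * f2 y)).
{ intros y; destruct (Hode y) as (Hf & Hf1 & _); unfold h.
  auto_derive.
  - split; [exists (f1 y); exact Hf|split; [exists (f2 y); exact Hf1|exact I]].
  - rewrite (is_derive_unique (fun t : R => f t) _ _ Hf),
      (is_derive_unique (fun t : R => f1 t) _ _ Hf1); ring. }
assert (E1 : forall x, Derive (fun t => / cosh t * f (tanh t)) x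
                       = / cosh x * h (tanh x)).
{ intros x; apply is_derive_unique, D1. }
assert (D2 : forall x, is_derive (Derive (fun t => / cosh t * f (tanh t))) x
  (/ cosh x * (- tanh x * h (tanh x) + (1 - tanh x ^ 2)
     * (- f (tanh x) - 3 * tanh x * f1 (tanh x)
        + (1 - tanh x ^ 2) * f2 (tanh x))))).
{ intros x; apply (is_derive_ext (fun t => / cosh t * h (tanh t))).
  - intros t; symmetry; apply E1.
  - apply is_derive_sech_mul_comp_tanh, Dh. }
split; [|split; [|split]].
- destruct (comp_tanh_neq0 f) as [x Hx]; [|exact Hpos|].
  + apply (ex_derive_continuous f); exists (f1 1); apply Hode.
  + exists x; apply Rmult_integral_contrapositive_currified; [|exact Hx].
    apply Rinv_neq_0_compat, Rgt_not_eq, cosh_pos.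
- intros x; eexists; apply D1.
- intros x; eexists; apply D2.
- intros x; rewrite (is_derive_unique _ _ _ (D2 x)), E1; unfold Rdiv.
  rewrite sech_sqr; unfold h.
  destruct (Hode (tanh x)) as (_ & _ & H).
  (* [1 <= j] makes the truncated [j - 1] a true difference. With [k = j - 1] and
     [alpha + beta = (m0 + m1) / 2 + 1], [k (k + 1 + alpha + beta) = j (j + (m0 + m1) / 2) - 1 - (m0
     + m1) / 2]. *)
  rewrite minus_INR in H by exact hj; simpl INR in H.
  (* Since [/ cosh x ^ 2] is already [1 - y ^ 2], the goal is now algebraic in [y], the values of
     [f], [f1], [f2] at [y], and the common factor [/ cosh x]. *)
  generalize dependent (tanh x); intros y H.
  apply (f_equal (Rmult (/ cosh x * (1 - y ^ 2)))) in H.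
  rewrite Rmult_0_r in H; rewrite <- H.
  assert (INR g <> 0) by (apply not_0_INR; lia).
  pose proof (cosh_pos x).
  field; lra.
Qed.
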